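(* Assume that $\bar\mu(\rho)>0$ and $\varepsilon(\rho)\ge 0$ for $\rho>0$. Then there exists no phase transition for a periodic traveling wave solution $(\rho,m)$ of the one-dimensional isothermal Navier-Stokes-Korteweg equations $$\partial_t\rho+\partial_x m=0,\qquad \partial_t m+\partial_x\!\left(\frac{m^2}{\rho}\right)+\partial_x p-\partial_x\big(\bar\mu\,\partial_x u\big)=\rho\,\partial_x\big(\varepsilon\,\partial_x^2\rho\big)\quad\text{in }\mathbb{R}\times(0,\infty).$$ That is, if $c$ is the speed of the traveling wave, the mass flux $j=m-\rho c$ vanishes identically (in other words, $u=c$).
   Context: Here $\rho=\rho(x,t)$ is the density, $m=m(x,t)$ is the (scalar) momentum, and $u=m/\rho$ is the velocity. The pressure $p=p(\rho)$ is a given function that is locally Lipschitz for $\rho>0$; it is not assumed to be monotone in $\rho$. The Korteweg relaxation parameter $\varepsilon=\varepsilon(\rho)$ is a given function, continuous for $\rho\ge0$. The viscosity is $\bar\mu=\bar\mu(\rho)=\lambda(\rho)+2\mu(\rho)$, where $\mu$ is the shear viscosity and $\lambda$ is the bulk viscosity. A solution $(\rho,m)$ is a traveling wave solution with speed $c\in\mathbb{R}$ if there are profile functions $\bar\rho,\bar m$ such that $(\rho(x,t),m(x,t))=(\bar\rho(x-ct),\bar m(x-ct))$. It is periodic if there is a period $T>0$ such that $(\rho(x,t),m(x,t))=(\rho(x,t+T),m(x,t+T))$; in the frame moving with speed $c$ (Galilean transformation $\tilde x=x-ct$, $\tilde u=u-c$), a periodic traveling wave solution with period $T$ and speed $c$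 is regarded as a stationary solution with periodic boundary condition with period $cT$. The mass flux is $j=\rho u-\rho c=m-\rho c$. One says that there exists no phase transition for a traveling wave solution if $j\equiv0$; otherwise one says that there exists phase transition.
   Formalization: Constant states (ρ,m) are excluded, since they are traveling waves of every speed c and j need not vanish; for c=0, where time periodicity is vacuous, a spatial period is required. Solutions are classical with ρ>0. *)

(* Defs.v *)
From Stdlib Require Import Reals.
From Coquelicot Require Import Coquelicot.
Open Scope R_scope.

(** Fields are functions [f x t] of position and time; only their values at
    times [t > 0] matter. *)

Definition ex_dx (f : R -> R -> R) (x t : R) : Prop :=
  ex_derive (fun y => f y t) x.
Definition ex_dt (f : R -> R -> R) (x t : R) : Prop :=
  ex_derive (fun s => f x s) t.
Definition dx (f : R -> R -> R) (x t : R) : R := Derive (fun y => f y t) x.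
Definition dt (f : R -> R -> R) (x t : R) : R := Derive (fun s => f x s) t.

Definition locally_lipschitz_pos (p : R -> R) : Prop :=
  forall r, 0 < r -> exists L : R, exists delta : posreal,
    forall a b, 0 < a -> 0 < b ->
      Rabs (a - r) < delta -> Rabs (b - r) < delta ->
      Rabs (p a - p b) <= L * Rabs (a - b).

Definition total_viscosity (lam mu : R -> R) (r : R) : R := lam r + 2 * mu r.

Definition velocity (rho m : R -> R -> R) (x t : R) : R := m x t / rho x t.

Definition viscous_stress (lam mu : R -> R) (rho m : R -> R -> R) (x t : R) : R :=
  total_viscosity lam mu (rho x t) * dx (velocity rho m) x t.

Definition korteweg_term (eps : R -> R) (rho : R -> R -> R) (x t : R) : R :=
  eps (rho x t) * dx (dx rho) x t.

(** [Derive] is total with a junk value where the derivative does not exist,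
    so the existence of every derivative occurring in the system is required
    explicitly. *)
Record classical_regularity (p eps lam mu : R -> R) (rho m : R -> R -> R)
    (x t : R) : Prop := {
  reg_rho_t : ex_dt rho x t;
  reg_rho_x : ex_dx rho x t;
  reg_rho_xx : ex_dx (dx rho) x t;
  reg_m_t : ex_dt m x t;
  reg_m_x : ex_dx m x t;
  reg_u_x : ex_dx (velocity rho m) x t;
  reg_convection_x : ex_dx (fun y s => m y s ^ 2 / rho y s) x t;
  reg_pressure_x : ex_dx (fun y s => p (rho y s)) x t;
  reg_viscous_x : ex_dx (viscous_stress lam mu rho m) x t;
  reg_korteweg_x : ex_dx (korteweg_term eps rho) x t
}.

Definition mass_equation (rho m : R -> R -> R) (x t : R) : Prop :=
  dt rho x t + dx m x t = 0.

Definition momentum_equation (p eps lam mu : R -> R) (rho m : R -> R -> R)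
    (x t : R) : Prop :=
  dt m x t + dx (fun y s => m y s ^ 2 / rho y s) x t
    + dx (fun y s => p (rho y s)) x t
    - dx (viscous_stress lam mu rho m) x t
  = rho x t * dx (korteweg_term eps rho) x t.

Definition NSK_solution (p eps lam mu : R -> R) (rho m : R -> R -> R) : Prop :=
  forall x t, 0 < t ->
    0 < rho x t /\
    classical_regularity p eps lam mu rho m x t /\
    mass_equation rho m x t /\
    momentum_equation p eps lam mu rho m x t.

Definition traveling_wave (c : R) (rho m : R -> R -> R) : Prop :=
  exists rhobar mbar : R -> R, forall x t, 0 < t ->
    rho x t = rhobar (x - c * t) /\ m x t = mbar (x - c * t).

Definition time_periodic (T : R) (rho m : R -> R -> R) : Prop :=
  forall x t, 0 < t -> rho x (t + T) = rho x t /\ m x (t + T) = m x t.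

Definition space_periodic (L : R) (rho m : R -> R -> R) : Prop :=
  forall x t, 0 < t -> rho (x + L) t = rho x t /\ m (x + L) t = m x t.

(** For [c <> 0], time period [T] amounts to the profile having period
    [c * T].  For [c = 0] every stationary field is time periodic and
    [c * T = 0] is no period at all (a standing viscous shock profile would
    qualify), so there the periodic boundary condition in [x] is required
    directly. *)
Definition periodic_traveling_wave (c : R) (rho m : R -> R -> R) : Prop :=
  traveling_wave c rho m /\
  (exists T, 0 < T /\ time_periodic T rho m) /\
  (c = 0 -> exists L, 0 < L /\ space_periodic L rho m).

(** A constant state is a traveling wave with every speed [c], so neither its
    speed nor its mass flux is determined. *)
Definition constant_state (rho m : R -> R -> R) : Prop :=
  exists r0 m0 : R, forall x t, 0 < t -> rho x t = r0 /\ m x t = m0.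

Definition mass_flux (c : R) (rho m : R -> R -> R) (x t : R) : R :=
  m x t - rho x t * c.

Definition no_phase_transition (c : R) (rho m : R -> R -> R) : Prop :=
  forall x t, 0 < t -> mass_flux c rho m x t = 0.

(* Main.v *)
Require Import Defs.
From Stdlib Require Import Reals.
From Coquelicot Require Import Coquelicot.
From Stdlib Require Import Lra.
Open Scope R_scope.

(** In the moving frame the mass equation says that [j = m - c rho] is
    constant, so [u = c + j / rho] and the momentum equation becomes
    [(j^2 / rho)' + (p(rho))' + F' = rho (eps rho'')'] with
    [F = nu(rho) j rho' / rho^2], where [nu = lam + 2 mu].  Dividing by [rho]
    makes every term but one an exact derivative: with [Q' (s) = p(s) / s^2],
    the function
    [H = j^2 / (2 rho^2) + p(rho) / rho + Q(rho) + F / rho - eps rho'']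
    satisfies [H' = - j nu(rho) rho'^2 / rho^4].  Hence [- j H] is
    nondecreasing; being periodic, it is constant, so [j rho' = 0] everywhere
    ([profile_flux_or_flat]).  If [j <> 0], then [rho], and with it
    [m = c rho + j], is constant, which is excluded.

    Dividing the pressure term by [rho] and integrating by parts, instead of
    using an enthalpy [p'(s) / s], requires only continuity of [p]; and the
    sign of [H'] replaces integration over a period, so that no integrability
    of the derivatives in the system is needed. *)

(** * Monotonicity, periodicity and primitives *)

Lemma derive_nonneg_le (f df : R -> R) :
  (forall x, is_derive f x (df x)) -> (forall x, 0 <= df x) ->
  forall a b, a <= b -> f a <= f b.
Proof.
intros Hd Hpos a b Hab.
destruct (MVT_gen f a b df) as [z [_ Hz]].
- intros x _; apply Hd.
- intros x _. apply continuity_pt_filterlim.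
  apply (ex_derive_continuous f x). exists (df x); apply Hd.
- assert (0 <= df z * (b - a)) by (apply Rmult_le_pos; [apply Hpos | lra]).
  lra.
Qed.

(** The period [P] may have either sign. *)
Lemma periodic_derive_nonneg_eq0 (f df : R -> R) (P : R) :
  P <> 0 -> (forall x, f (x + P) = f x) ->
  (forall x, is_derive f x (df x)) -> (forall x, 0 <= df x) ->
  forall x, df x = 0.
Proof.
intros HP Hper Hd Hpos x.
assert (Hmon := derive_nonneg_le f df Hd Hpos).
assert (Hper' : f (x - Rabs P / 2) = f (x + Rabs P / 2)).
{ unfold Rabs; destruct (Rcase_abs P).
  - rewrite <- (Hper (x + - P / 2)); f_equal; lra.
  - rewrite <- (Hper (x - P / 2)); f_equal; lra. }
assert (HP2 : 0 < Rabs P / 2) by (assert (H := Rabs_pos_lt P HP); lra).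
assert (H0 : is_derive f x 0).
{ apply (is_derive_ext_loc (fun _ => f x)).
  - exists (mkposreal _ HP2); intros y Hy.
    change (Rabs (y - x) < Rabs P / 2) in Hy.
    apply Rabs_def2 in Hy.
    assert (f (x - Rabs P / 2) <= f y) by (apply Hmon; lra).
    assert (f y <= f (x + Rabs P / 2)) by (apply Hmon; lra).
    assert (f (x - Rabs P / 2) <= f x) by (apply Hmon; lra).
    assert (f x <= f (x + Rabs P / 2)) by (apply Hmon; lra).
    lra.
  - apply (is_derive_const (f x) x). }
rewrite <- (is_derive_unique _ _ _ (Hd x)).
exact (is_derive_unique _ _ _ H0).
Qed.

Lemma derive_eq0_const (f : R -> R) :
  (forall x, ex_derive f x) -> (forall x, Derive f x = 0) ->
  forall x y, f x = f y.
Proof.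
intros Hex H0 x y.
destruct (MVT_gen f x y (Derive f)) as [z [_ Hz]].
- intros w _; apply Derive_correct, Hex.
- intros w _. apply continuity_pt_filterlim.
  apply (ex_derive_continuous f w), Hex.
- rewrite H0 in Hz; lra.
Qed.

Lemma Derive_periodic (f : R -> R) (P : R) :
  (forall x, f (x + P) = f x) -> forall x, Derive f (x + P) = Derive f x.
Proof.
intros Hper x.
rewrite <- (Derive_ext _ _ x Hper).
unfold Derive. f_equal. apply Lim_ext; intros h.
replace (x + h + P) with (x + P + h) by ring. reflexivity.
Qed.

Lemma primitive_pos (g : R -> R) :
  (forall r, 0 < r -> continuous g r) ->
  exists G : R -> R, forall r, 0 < r -> is_derive G r (g r).
Proof.
intros Hg. exists (fun r => RInt g 1 r). intros r Hr.
apply (is_derive_RInt g (fun s => RInt g 1 s) 1 r).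
- exists (mkposreal r Hr); intros s Hs.
  change (Rabs (s - r) < r) in Hs.
  apply Rabs_def2 in Hs.
  apply (RInt_correct g 1 s), (ex_RInt_continuous g 1 s).
  intros z [Hz _]. apply Hg.
  assert (0 < Rmin 1 s) by (apply Rmin_pos; lra). lra.
- apply Hg, Hr.
Qed.

Lemma locally_lipschitz_pos_continuous (p : R -> R) :
  locally_lipschitz_pos p -> forall r, 0 < r -> continuous p r.
Proof.
intros Hp r Hr. destruct (Hp r Hr) as [L [d HL]].
apply continuity_pt_filterlim.
intros e He.
assert (HL1 : 0 < Rabs L + 1) by (assert (H := Rabs_pos L); lra).
exists (Rmin (Rmin d r) (e / (Rabs L + 1))). split.
- apply Rmin_pos; [apply Rmin_pos; [apply cond_pos | exact Hr] |].
  apply Rdiv_lt_0_compat; lra.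
- intros y [_ Hy]. change (Rabs (y - r) < Rmin (Rmin d r) (e / (Rabs L + 1))) in Hy.
  change (Rabs (p y - p r) < e).
  assert (H1 := Rmin_l (Rmin d r) (e / (Rabs L + 1))).
  assert (H2 := Rmin_r (Rmin d r) (e / (Rabs L + 1))).
  assert (H3 := Rmin_l d r). assert (H4 := Rmin_r d r).
  assert (Hy0 : 0 < y)
    by (assert (Hyr : Rabs (y - r) < r) by lra; apply Rabs_def2 in Hyr; lra).
  assert (Hrr : Rabs (r - r) < d)
    by (rewrite Rminus_diag, Rabs_R0; apply cond_pos).
  assert (Hyd : Rabs (y - r) < d) by lra.
  assert (Hl := HL y r Hy0 Hr Hyd Hrr).
  assert (L * Rabs (y - r) <= (Rabs L + 1) * Rabs (y - r)).
  { apply Rmult_le_compat_r; [apply Rabs_pos |].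
    assert (H := Rle_abs L); lra. }
  assert ((Rabs L + 1) * Rabs (y - r) < (Rabs L + 1) * (e / (Rabs L + 1)))
    by (apply Rmult_lt_compat_l; lra).
  replace ((Rabs L + 1) * (e / (Rabs L + 1))) with e in * by (field; lra).
  lra.
Qed.

(** * Periodic profiles *)

(** The dichotomy for periodic solutions [r] of the profile equation with
    constant mass flux [j]: [nu] is the viscosity, and the equation is the
    momentum balance with velocity eliminated through [u = c + j / r]. *)
Lemma profile_flux_or_flat (p nu eps r : R -> R) (j P : R) :
  (forall s, 0 < s -> continuous p s) ->
  (forall s, 0 < s -> 0 < nu s) ->
  P <> 0 -> (forall y, r (y + P) = r y) -> (forall y, 0 < r y) ->
  let F := fun y => nu (r y) * (j * Derive r y / r y ^ 2) in
  let K := fun y => eps (r y) * Derive (Derive r) y in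
  (forall y, ex_derive r y) ->
  (forall y, ex_derive (fun z => p (r z)) y) ->
  (forall y, ex_derive F y) ->
  (forall y, ex_derive K y) ->
  (forall y, - (j ^ 2 * Derive r y / r y ^ 2) + Derive (fun z => p (r z)) y
             + Derive F y = r y * Derive K y) ->
  j = 0 \/ forall y, Derive r y = 0.
Proof.
intros Hp Hnu HP Hper Hr F K Hdr Hdp HdF HdK Heq.
destruct (primitive_pos (fun s => p s / s ^ 2)) as [Q HQ].
{ intros s Hs. apply (continuous_mult p (fun s => / s ^ 2)).
  - apply Hp, Hs.
  - apply (ex_derive_continuous (fun s => / s ^ 2)).
    auto_derive. assert (s * (s * 1) <> 0) by nra. auto. }
(* Up to the profile equation, [H' = - F r' / r^2]: in [(p(r) / r)'] the
   term [- p(r) r' / r^2] cancels against [(Q o r)'], and the remaining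
   defect comes from the quotient [F / r]. *)
pose (H := fun y => j ^ 2 / (2 * r y ^ 2) + p (r y) / r y + Q (r y)
                    + F y / r y - K y).
assert (HF : forall y, F (y + P) = F y).
{ intros y; unfold F; rewrite (Derive_periodic r P Hper), Hper; reflexivity. }
assert (HK : forall y, K (y + P) = K y).
{ intros y; unfold K.
  rewrite (Derive_periodic _ P (Derive_periodic r P Hper)), Hper.
  reflexivity. }
assert (HH : forall y, - j * H (y + P) = - j * H y).
{ intros y; unfold H; rewrite HF, HK, Hper; reflexivity. }
assert (HdH : forall y, is_derive (fun z => - j * H z) y
                (nu (r y) * (j * Derive r y / r y ^ 2) ^ 2)).
{ intros y.
  assert (Hry := Hr y).
  assert (Hr' := Derive_correct _ _ (Hdr y)).
  assert (Hp' := Derive_correct _ _ (Hdp y)).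
  assert (HF' := Derive_correct _ _ (HdF y)).
  assert (HK' := Derive_correct _ _ (HdK y)).
  assert (HQ' := is_derive_comp Q r y _ _ (HQ (r y) Hry) Hr').
  assert (Hi : is_derive (fun z => / r z) y (- Derive r y / r y ^ 2))
    by (apply is_derive_inv; [exact Hr' | lra]).
  assert (Hi2 := is_derive_scal _ y (j ^ 2 / 2) _
                   (is_derive_mult _ _ y _ _ Hi Hi Rmult_comm)).
  assert (HPi := is_derive_mult _ _ y _ _ Hp' Hi Rmult_comm).
  assert (HFi := is_derive_mult _ _ y _ _ HF' Hi Rmult_comm).
  assert (HA := is_derive_scal _ y (- j) _
    (is_derive_minus _ _ y _ _ (is_derive_plus _ _ y _ _
      (is_derive_plus _ _ y _ _ (is_derive_plus _ _ y _ _ Hi2 HPi) HQ')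
      HFi) HK')).
  eapply is_derive_ext; [| eapply eq_rect; [exact HA |]].
  - intros z; unfold H, minus, plus, opp, mult; simpl.
    assert (Hrz := Hr z). field. lra.
  - assert (Heqy := Heq y).
    replace (Derive K y) with
      ((- (j ^ 2 * Derive r y / r y ^ 2) + Derive (fun z => p (r z)) y
         + Derive F y) / r y)
      by (rewrite Heqy; field; lra).
    unfold minus, plus, opp, mult, scal; simpl; unfold mult; simpl.
    set (F' := Derive F y). unfold F. field. lra. }
assert (Hz := periodic_derive_nonneg_eq0 _ _ P HP HH HdH).
destruct (Req_dec j 0) as [Hj | Hj]; [now left | right].
intros y.
assert (Hpos : 0 < r y ^ 2) by (apply pow_lt, Hr).
assert (H2 : (j * Derive r y / r y ^ 2) ^ 2 = 0).
{ destruct (Rmult_integral _ _ (Hz (fun x =>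
    Rmult_le_pos _ _ (Rlt_le _ _ (Hnu _ (Hr x))) (pow2_ge_0 _)) y))
    as [E | E]; [| exact E].
  assert (E' := Hnu _ (Hr y)); lra. }
assert (H1 : j * Derive r y / r y ^ 2 = 0) by nra.
assert (H0 : j * Derive r y = 0).
{ replace (j * Derive r y) with (j * Derive r y / r y ^ 2 * r y ^ 2)
    by (field; assert (E := Hr y); lra).
  rewrite H1; ring. }
destruct (Rmult_integral _ _ H0); [contradiction | assumption].
Qed.

(** * Time slices of traveling waves *)

(** A traveling wave is determined by its slice at time [1]. *)
Lemma traveling_wave_slice (c : R) (rho m : R -> R -> R) :
  traveling_wave c rho m -> forall x t, 0 < t ->
  rho x t = rho (x - c * (t - 1)) 1 /\ m x t = m (x - c * (t - 1)) 1.
Proof.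
intros [rb [mb Hw]] x t Ht.
destruct (Hw x t Ht) as [-> ->].
destruct (Hw (x - c * (t - 1)) 1 Rlt_0_1) as [-> ->].
split; f_equal; ring.
Qed.

Lemma dt_traveling (f : R -> R -> R) (c x : R) :
  (forall t, 0 < t -> f x t = f (x - c * (t - 1)) 1) ->
  ex_dx f x 1 -> dt f x 1 = - c * dx f x 1.
Proof.
intros Hf Hex. unfold dt, dx.
apply is_derive_unique.
apply (is_derive_ext_loc (fun t => f (x - c * (t - 1)) 1)).
{ exists (mkposreal 1 Rlt_0_1); intros t Htt.
  change (Rabs (t - 1) < 1) in Htt. apply Rabs_def2 in Htt.
  symmetry; apply Hf; lra. }
apply (is_derive_comp (fun y => f y 1) (fun t => x - c * (t - 1)) 1).
- replace (x - c * (1 - 1)) with x by ring. apply Derive_correct, Hex.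
- auto_derive; [exact I | ring].
Qed.

Lemma periodic_traveling_wave_slice (c : R) (rho m : R -> R -> R) :
  periodic_traveling_wave c rho m ->
  exists P, P <> 0 /\ forall y, rho (y + P) 1 = rho y 1.
Proof.
intros [Hw [[T [HT Hper]] Hc0]].
destruct (Req_dec c 0) as [Hc | Hc].
- destruct (Hc0 Hc) as [L [HL HLper]].
  exists L; split; [lra |]. intros y; apply (HLper y 1 Rlt_0_1).
- exists (- (c * T)); split.
  { intros E. assert (E' : c * T = 0) by lra.
    destruct (Rmult_integral _ _ E'); lra. }
  intros y. rewrite <- (proj1 (Hper y 1 Rlt_0_1)).
  assert (H1T : 0 < 1 + T) by lra.
  rewrite (proj1 (traveling_wave_slice c rho m Hw y (1 + T) H1T)).
  f_equal; ring.
Qed.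

(** * Absence of phase transition *)

Theorem corollary2p2 (p eps lam mu : R -> R)
    (hp : locally_lipschitz_pos p)
    (heps : continuous_on (fun r => 0 <= r) eps)
    (hvisc_pos : forall r, 0 < r -> 0 < total_viscosity lam mu r)
    (heps_nonneg : forall r, 0 < r -> 0 <= eps r)
    (c : R) (rho m : R -> R -> R)
    (hsol : NSK_solution p eps lam mu rho m)
    (hper : periodic_traveling_wave c rho m)
    (hnonconst : ~ constant_state rho m) :
  no_phase_transition c rho m /\
  (forall x t, 0 < t -> velocity rho m x t = c).
Proof.
assert (Hw := proj1 hper).
assert (Hslice := traveling_wave_slice c rho m Hw).
destruct (periodic_traveling_wave_slice c rho m hper) as [P [HP HrP]].
pose (r := fun y => rho y 1).
pose (nu := total_viscosity lam mu).
assert (Hr : forall y, 0 < r y) by (intros y; apply (hsol y 1 Rlt_0_1)).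
assert (Hreg : forall y, classical_regularity p eps lam mu rho m y 1)
  by (intros y; apply (hsol y 1 Rlt_0_1)).
assert (Hdr : forall y, ex_derive r y)
  by (intros y; apply (reg_rho_x _ _ _ _ _ _ _ _ (Hreg y))).
assert (Hdm : forall y, ex_derive (fun z => m z 1) y)
  by (intros y; apply (reg_m_x _ _ _ _ _ _ _ _ (Hreg y))).
assert (Htr : forall y, dt rho y 1 = - c * Derive r y).
{ intros y; apply (dt_traveling rho c y); [| apply Hdr].
  intros t Ht; apply Hslice, Ht. }
assert (Htm : forall y, dt m y 1 = - c * Derive (fun z => m z 1) y).
{ intros y; apply (dt_traveling m c y); [| apply Hdm].
  intros t Ht; apply Hslice, Ht. }
assert (Hmass : forall y, Derive (fun z => m z 1) y = c * Derive r y).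
{ intros y. destruct (hsol y 1 Rlt_0_1) as [_ [_ [E _]]].
  unfold mass_equation in E. rewrite Htr in E. unfold dx in E. lra. }
pose (j := m 0 1 - c * r 0).
assert (Hm : forall y, m y 1 = c * r y + j).
{ assert (Hcst : forall y z, m y 1 - c * r y = m z 1 - c * r z).
  { assert (Hd : forall y, is_derive (fun z => m z 1 - c * r z) y 0).
    { intros y.
      assert (E := is_derive_minus _ _ y _ _ (Derive_correct _ _ (Hdm y))
                (is_derive_scal r y c _ (Derive_correct _ _ (Hdr y)))).
      rewrite Hmass in E.
      replace 0 with (minus (c * Derive r y) (c * Derive r y))
        by (unfold minus, plus, opp; simpl; ring).
      exact E. }
    apply (derive_eq0_const (fun y => m y 1 - c * r y)).
    - intros y; exists 0; apply Hd.
    - intros y; apply is_derive_unique, Hd. }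
  intros y; unfold j; rewrite <- (Hcst y 0); ring. }
assert (Hinv : forall y, is_derive (fun z => / r z) y (- Derive r y / r y ^ 2)).
{ intros y; apply is_derive_inv; [apply Derive_correct, Hdr |].
  assert (E := Hr y); lra. }
assert (Hu : forall y, dx (velocity rho m) y 1 = - (j * Derive r y / r y ^ 2)).
{ intros y; unfold dx, velocity; apply is_derive_unique.
  apply (is_derive_ext (fun z => c + j * / r z)).
  { intros z; rewrite Hm; fold (r z). assert (E := Hr z).
    simpl; field; lra. }
  assert (E := is_derive_plus _ _ y _ _ (is_derive_const c y)
                 (is_derive_scal _ y j _ (Hinv y))).
  eapply eq_rect; [exact E |]. unfold plus, zero; simpl.
  assert (E' := Hr y); field; lra. }
(* [m^2 / rho = c^2 rho + 2 c j + j^2 / rho]; the part in [c^2] cancels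
   against [dt m]. *)
assert (Hconv : forall y, dx (fun z s => m z s ^ 2 / rho z s) y 1
                  = c ^ 2 * Derive r y - j ^ 2 * Derive r y / r y ^ 2).
{ intros y; unfold dx; apply is_derive_unique.
  apply (is_derive_ext (fun z => c ^ 2 * r z + (2 * c * j + j ^ 2 * / r z))).
  { intros z; rewrite Hm; fold (r z). assert (E := Hr z).
    simpl; field; lra. }
  assert (E := is_derive_plus _ _ y _ _
    (is_derive_scal r y (c ^ 2) _ (Derive_correct _ _ (Hdr y)))
    (is_derive_plus _ _ y _ _ (is_derive_const (2 * c * j) y)
                 (is_derive_scal _ y (j ^ 2) _ (Hinv y)))).
  eapply eq_rect; [exact E |]. unfold plus, zero; simpl.
  assert (E' := Hr y); field; lra. }
(* [F] is minus the viscous stress, because [u' = - j r' / r^2]. *)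
pose (F := fun y => nu (r y) * (j * Derive r y / r y ^ 2)).
assert (HFv : forall y, is_derive F y (- dx (viscous_stress lam mu rho m) y 1)).
{ intros y.
  apply (is_derive_ext (fun z => - viscous_stress lam mu rho m z 1)).
  { intros z; unfold viscous_stress; rewrite Hu; unfold F, nu, r.
    simpl; ring. }
  apply (is_derive_opp (fun z => viscous_stress lam mu rho m z 1)).
  apply Derive_correct, (reg_viscous_x _ _ _ _ _ _ _ _ (Hreg y)). }
destruct (profile_flux_or_flat p nu eps r j P) as [Hj | Hflat].
- apply locally_lipschitz_pos_continuous, hp.
- exact hvisc_pos.
- exact HP.
- exact HrP.
- exact Hr.
- exact Hdr.
- intros y; apply (reg_pressure_x _ _ _ _ _ _ _ _ (Hreg y)).
- intros y; eexists; apply HFv.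
- intros y; apply (reg_korteweg_x _ _ _ _ _ _ _ _ (Hreg y)).
- intros y. fold F. rewrite (is_derive_unique _ _ _ (HFv y)).
  destruct (hsol y 1 Rlt_0_1) as [_ [_ [_ E]]].
  unfold momentum_equation in E. rewrite Htm, Hmass, Hconv in E.
  change (r y * Derive (fun z => eps (r z) * Derive (Derive r) z) y)
    with (rho y 1 * dx (korteweg_term eps rho) y 1).
  change (Derive (fun z => p (r z)) y)
    with (dx (fun z s => p (rho z s)) y 1).
  rewrite <- E. ring.
- assert (Hflux : forall x t, 0 < t -> m x t = c * rho x t).
  { intros x t Ht. destruct (Hslice x t Ht) as [-> ->].
    rewrite Hm, Hj. unfold r; ring. }
  split; intros x t Ht.
  + unfold mass_flux; rewrite (Hflux x t Ht); ring.
  + unfold velocity; rewrite (Hflux x t Ht).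
    assert (E := proj1 (hsol x t Ht)). field; lra.
- exfalso; apply hnonconst. exists (r 0), (m 0 1).
  assert (Hcr := derive_eq0_const r Hdr Hflat).
  intros x t Ht. destruct (Hslice x t Ht) as [-> ->]. split.
  + apply (Hcr _ 0).
  + rewrite !Hm, (Hcr _ 0). reflexivity.
Qed.
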